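(* Let $\mathcal{Z}$ be a global cross section for the action of $\mathcal{G}$ on $\mathcal{X}$, with orbital decomposition $x\leftrightarrow (y(x),z(x))\in\mathcal{Y}\times\mathcal{Z}$, and let $\lambda$ be a relatively invariant measure on $\mathcal{X}$ with multiplier $\chi$, factored as $\lambda(dx)=\chi(y)\,\mu_{\mathcal{Y}}(dy)\,\nu_{\mathcal{Z}}(dz)$ with $\nu_{\mathcal{Z}}$ a probability measure (all as in the context). Suppose that $x$ is distributed according to a cross-sectionally contoured distribution $f_{\mathcal{Y}}(y(x))\lambda(dx)$. Then: 1. $y=y(x)$ and $z=z(x)$ are independently distributed. 2. The distribution of $z$ does not depend on $f_{\mathcal{Y}}$. 3. The distribution of $y$ is $f_{\mathcal{Y}}(y)\,\chi(y)\,\mu_{\mathcal{Y}}(dy)$.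
   Context: A group $\mathcal{G}$ acts on a space $\mathcal{X}$ from the left. The isotropy subgroup at $x$ is $\mathcal{G}_x=\{g\in\mathcal{G}: gx=x\}$. A cross section is a subset $\mathcal{Z}\subset\mathcal{X}$ meeting each orbit $\mathcal{G}x$ in exactly one point; it is a global cross section if $\mathcal{G}_z=\mathcal{G}_0$ is the same subgroup for all $z\in\mathcal{Z}$. Put $\mathcal{Y}=\mathcal{G}/\mathcal{G}_0$ (left cosets) and $\pi:\mathcal{G}\to\mathcal{Y}$, $\pi(g)=g\mathcal{G}_0$. The orbital decomposition with respect to $\mathcal{Z}$ is the bijection $\mathcal{X}\leftrightarrow\mathcal{Y}\times\mathcal{Z}$, $x\leftrightarrow(y,z)$, where $x=gz$, $y=\pi(g)$; write $y=y(x)$ (equivariant part) and $z=z(x)$ (invariant part). Standing assumptions (measurability means Borel measurability; quotient spaces carry the quotient topology): (1) $\mathcal{X}$ is a locally compact Hausdorff space; (2) $\mathcal{G}$ is a second countable, locally compact Hausdorff topological group acting continuously on $\mathcal{X}$; (3) $\mathcal{G}_0$ is compact; (4) $\mathcal{Z}$ is locally compact in the relative topology, and the bijection $x\leftrightarrow(y,z)$ is bimeasurable. $\lambda$ is a measure on $\mathcal{X}$ that is relatively invariant with multiplier $\chi$: $\lambda(d(gx))=\chi(g)\lambda(dx)$, $g\in\mathcal{G}$, where $\chi$ is a continuous homomorphism from $\mathcal{G}$ to the multiplicative group of positive reals. $\mu_{\mathcal{G}}$ is a left Haar measure on $\mathcal{G}$, $\mu_{\mathcal{Y}}=\mu_{\mathcal{G}}\pi^{-1}$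 is the induced measure on $\mathcal{Y}$, and $\chi(y):=\chi(g)$ for any $g\in\pi^{-1}(\{y\})$ (well defined because $\mathcal{G}_0$ is compact). The measure $\lambda$ factors as $\lambda(dx)=\chi(y)\mu_{\mathcal{Y}}(dy)\nu_{\mathcal{Z}}(dz)$, and it is assumed that $\nu_{\mathcal{Z}}$ is standardized to be a probability measure on $\mathcal{Z}$. A distribution (probability measure) on $\mathcal{X}$ is cross-sectionally contoured with respect to $\mathcal{Z}$ if it is of the form $f_{\mathcal{Y}}(y(x))\lambda(dx)$ for some function $f_{\mathcal{Y}}$ on $\mathcal{Y}$. *)

(* Defs.v *)
From HB Require Import structures.
From mathcomp Require Import all_boot all_order all_algebra.
From mathcomp Require Import generic_quotient all_classical all_reals all_analysis.
Import numFieldNormedType.Exports.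

Set Implicit Arguments.
Unset Strict Implicit.
Unset Printing Implicit Defensive.

Local Open Scope classical_set_scope.
Local Open Scope ring_scope.
Local Open Scope quotient_scope.

HB.mixin Record Group_Topological_isTopologicalGroup G
    & Group G & Topological G := {
  mulg_continuous : continuous (fun p : G * G => (p.1 * p.2)%g) ;
  invg_continuous : continuous (fun g : G => (g^-1)%g)
}.

#[short(type="topologicalGroupType")]
HB.structure Definition TopologicalGroup :=
  {G of Group G & Topological G & Group_Topological_isTopologicalGroup G}.

(* The library's measurable types are pointed, whereas a topological space need
   not be.  [borel t] is the Borel measurable space of the space containing
   [t]; its sigma-algebra does not depend on the point [t]. *)
Definition pointed_at (T : topologicalType) (t : T) : Type := T.

HB.instance Definition _ (T : topologicalType) (t : T) :=
  Topological.on (pointed_at t).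
HB.instance Definition _ (T : topologicalType) (t : T) :=
  isPointed.Build (pointed_at t) t.

Notation borel t := (g_sigma_algebraType (@open (pointed_at t))).

Section coset_space.
Context {G : groupType}.
Variable G0 : groupClosed G.

Definition lcoset_rel : rel G := fun g h => (g^-1 * h)%g \in G0.

Lemma lcoset_rel_refl : reflexive lcoset_rel.
Proof. by move=> g; rewrite /lcoset_rel mulVg gpred1. Qed.

Lemma lcoset_rel_sym : symmetric lcoset_rel.
Proof. by move=> g h; rewrite /lcoset_rel -gpredV invgM invgK. Qed.

Lemma lcoset_rel_trans : transitive lcoset_rel.
Proof.
move=> h g k gh hk; rewrite /lcoset_rel.
suff -> : (g^-1 * k = (g^-1 * h) * (h^-1 * k))%g by exact: gpredM.
by rewrite mulgA mulgK.
Qed.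

Canonical lcoset_equiv :=
  EquivRel lcoset_rel lcoset_rel_refl lcoset_rel_sym lcoset_rel_trans.

End coset_space.

Notation coset_space G0 := (quotient_topology {eq_quot (lcoset_equiv G0)}).

Definition coset_proj (G : topologicalGroupType) (G0 : groupClosed G) :
  G -> coset_space G0 := fun g => \pi_(coset_space G0) g.

Section group_action.
Context {G : topologicalGroupType} {X : topologicalType}.
Variable act : G -> X -> X.

Definition left_action :=
  (forall x, act 1%g x = x) /\
  (forall g h x, act (g * h)%g x = act g (act h x)).

Definition continuous_action := continuous (fun p : G * X => act p.1 p.2).

Definition action_orbit (x : X) : set X := range (act ^~ x).

Definition isotropy (x : X) : set G := [set g | act g x = x].

Definition cross_section (Z : set X) :=
  forall x, exists! z, Z z /\ action_orbit x z.

Definition global_cross_section (Z : set X) (G0 : groupClosed G) :=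
  cross_section Z /\ forall z, Z z -> isotropy z = [set` G0].

(* For a global cross section these equations determine [y] and [z], and
   [x |-> (y x, z x)] is a bijection onto the product. *)
Definition orbital_decomposition (Z : set X) (G0 : groupClosed G)
    (y : X -> coset_space G0) (z : X -> Z) :=
  forall x, exists2 g, x = act g (set_val (z x)) & y x = coset_proj G0 g.

End group_action.

(* [f @` A] is the preimage of [A] under the inverse when [f] is bijective. *)
Definition bimeasurable d1 d2 (T1 : measurableType d1) (T2 : measurableType d2)
    (f : T1 -> T2) :=
  measurable_fun [set: T1] f /\ forall A, measurable A -> measurable (f @` A).

Section measures.
Context {R : realType}.
Local Open Scope ereal_scope.

Definition radon (T : topologicalType) (t : T)
    (mu : {measure set (borel t) -> \bar R}) :=
  [/\ forall K : set T, compact K -> mu K < +oo,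
      forall A : set (borel t), measurable A ->
        mu A = ereal_inf [set mu U | U in [set U : set T | open U /\ A `<=` U]] &
      forall U : set T, open U ->
        mu U = ereal_sup [set mu K | K in [set K : set T | compact K /\ K `<=` U]]].

Definition left_haar (G : topologicalGroupType)
    (mu : {measure set (borel (1%g : G)) -> \bar R}) :=
  [/\ mu [set: G] != 0,
      forall (g : G) (A : set (borel (1%g : G))), measurable A ->
        mu [set (g * h)%g | h in A] = mu A &
      radon mu].

Definition coset_measure (G : topologicalGroupType) (G0 : groupClosed G)
    (mu : {measure set (borel (1%g : G)) -> \bar R}) :
    set (borel (coset_proj G0 1%g)) -> \bar R :=
  pushforward mu (coset_proj G0 : borel (1%g : G) -> borel (coset_proj G0 1%g)).
Arguments coset_measure {G} G0 mu.

Definition multiplier (G : topologicalGroupType) (chi : G -> R) :=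
  [/\ continuous chi,
      (forall g, 0 < chi g)%R &
      (forall g h, chi (g * h)%g = chi g * chi h)%R].

(* Only meaningful when [chi] is trivial on [G0]. *)
Definition coset_multiplier (G : topologicalGroupType) (G0 : groupClosed G)
  (chi : G -> R) : coset_space G0 -> R := fun y => chi (repr y).

Definition relatively_invariant (G : topologicalGroupType)
    (X : topologicalType) (x0 : X) (act : G -> X -> X) (chi : G -> R)
    (lambda : {measure set (borel x0) -> \bar R}) :=
  forall (g : G) (A : set (borel x0)), measurable A ->
    lambda (act g @` A) = (chi g)%:E * lambda A.

(* lambda(dx) = chi(y) muY(dy) nuZ(dz) under x <-> (y, z) *)
Definition orbital_factorization (G : topologicalGroupType)
    (G0 : groupClosed G) (X : topologicalType) (x0 : X) (Z : set X) (z0 : Z)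
    (y : X -> coset_space G0) (z : X -> Z) (chi : G -> R)
    (muG : {measure set (borel (1%g : G)) -> \bar R})
    (nuZ : probability (borel z0) R)
    (lambda : {measure set (borel x0) -> \bar R}) :=
  forall A : set (borel x0), measurable A ->
    lambda A =
    \int[coset_measure G0 muG \x nuZ]_(p in [set (y x, z x) | x in A])
      (coset_multiplier chi p.1)%:E.

(* [P] has the form f(y(x)) lambda(dx). *)
Definition cross_sectionally_contoured (G : topologicalGroupType)
    (G0 : groupClosed G) (X : topologicalType) (x0 : X)
    (y : X -> coset_space G0) (lambda : {measure set (borel x0) -> \bar R})
    (f : borel (coset_proj G0 1%g) -> R) (P : set (borel x0) -> \bar R) :=
  measurable_fun [set: borel (coset_proj G0 1%g)] f /\
  forall A : set (borel x0), measurable A ->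
    P A = \int[lambda]_(x in A) (f (y x))%:E.

Definition independent_RVs d d1 d2 (Omega : measurableType d)
    (T1 : measurableType d1) (T2 : measurableType d2) (P : probability Omega R)
    (X : Omega -> T1) (Y : Omega -> T2) :=
  forall A B, measurable A -> measurable B ->
    P (X @^-1` A `&` Y @^-1` B) = P (X @^-1` A) * P (Y @^-1` B).

End measures.
Arguments coset_measure {R G} G0 mu.

(* Main.v *)
(** Under x <-> (y, z) the measure lambda becomes chi(y) muY(dy) nuZ(dz), so for
    g >= 0 and rectangles B x C, the integral of g(y(x)) over the preimage of
    B x C splits as (integral over B of g chi dmuY) * nuZ(C).  As f need not be
    nonnegative, one first notes that f^- chi has muY-integral 0, since P is
    nonnegative on {f(y) < 0}; the rectangle formula then holds for f itself, and
    B = Y gives the law of z, C = Z the law of y.  Only rectangles are needed, so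
    the Borel sets of Y x Z never have to be compared with the product
    sigma-algebra. *)
Require Import Defs.
From HB Require Import structures.
From mathcomp Require Import all_boot all_order all_algebra.
From mathcomp Require Import generic_quotient all_classical all_reals all_analysis.
From mathcomp Require Import measurable_realfun.
Import Order.TTheory GRing.Theory Num.Theory.
Import numFieldNormedType.Exports.
Import HBNNSimple.

Set Implicit Arguments.
Unset Strict Implicit.
Unset Printing Implicit Defensive.

Local Open Scope classical_set_scope.
Local Open Scope ring_scope.
Local Open Scope quotient_scope.

(** * Change of variables for the image of a weighted measure *)

Section weighted_image.
Context d d' (T : measurableType d) (T' : measurableType d') (R : realType).
Variables (mu : {measure set T -> \bar R}) (nu : {measure set T' -> \bar R}).
Variables (phi : T -> T') (w : T -> R).
Hypotheses (mphi : measurable_fun [set: T] phi) (mw : measurable_fun [set: T] w).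
Hypothesis w0 : forall x, 0 <= w x.
Hypothesis nuE :
  forall A, measurable A -> nu A = (\int[mu]_(x in phi @^-1` A) (w x)%:E)%E.
Variables (D : set T') (mD : measurable D).
Local Open Scope ereal_scope.

Let mpre A : measurable A -> measurable (phi @^-1` A).
Proof. by move=> mA; rewrite -[X in measurable X]setTI; exact: mphi. Qed.

Let integral_weighted_image_nnsfun (h : {nnsfun T' >-> R}) :
  \int[nu]_(t in D) (h t)%:E =
  \int[mu]_(x in phi @^-1` D) ((h (phi x))%:E * (w x)%:E).
Proof.
have mDphi := mpre mD.
under eq_integral do rewrite fimfunE -fsumEFin//.
have mi r : measurable_fun D (fun x => (r * \1_(h @^-1` [set r]) x)%:E).
  by apply: (measurable_comp measurableT) => //; exact: measurable_funM.
rewrite ge0_integral_fsum//; last by move=> r t _; exact: nnfun_muleindic_ge0.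
under [RHS]eq_integral => x _.
  rewrite fimfunE -fsumEFin// ge0_mule_fsuml => [|r]; last exact: nnfun_muleindic_ge0.
  over.
rewrite ge0_integral_fsum//; last 2 first.
- move=> r; apply: emeasurable_funM; last exact/measurable_funTS/measurable_EFinP.
  apply/measurable_funTS/measurable_EFinP; apply: measurable_funM => //.
  by apply: (measurableT_comp _ mphi); exact: measurable_indic.
- by move=> r x _; apply: mule_ge0; rewrite ?EFinM ?nnfun_muleindic_ge0// lee_fin.
apply: eq_fsbigr => r rhn; rewrite integralZl_indic_nnsfun//.
have r0 : (0 <= r)%R by move: rhn; rewrite inE => -[t _ <-].
under [RHS]eq_integral do rewrite EFinM -muleA.
rewrite ge0_integralZl//; last 2 first.
- apply: emeasurable_funM; last exact/measurable_funTS/measurable_EFinP.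
  apply/measurable_funTS/measurable_EFinP.
  by apply: (measurableT_comp _ mphi); exact: measurable_indic.
- by move=> x _; rewrite mule_ge0 ?lee_fin.
congr (_ * _); rewrite integral_indic// setIC.
rewrite nuE; last exact: measurableI.
rewrite preimage_setI integral_mkcondr; apply: eq_integral => x _.
by rewrite epatch_indic muleC.
Qed.

(** Monotone convergence extends the case of simple functions, applied on both sides. An indicator
    [w] yields the image of a restricted measure, and [phi := id] yields a change of density; both
    uses occur below. *)
Lemma ge0_integral_weighted_image (f : T' -> \bar R) :
  measurable_fun D f -> (forall t, D t -> 0 <= f t) ->
  \int[nu]_(t in D) f t = \int[mu]_(x in phi @^-1` D) (f (phi x) * (w x)%:E).
Proof.
move=> mf f0; have mDphi := mpre mD; pose h := nnsfun_approx mD mf.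
have hf t : D t -> EFin \o h ^~ t @ \oo --> f t.
  by move=> Dt; exact: cvg_nnsfun_approx.
have ndh t : {homo (fun n => (h n t)%:E) : a b / (a <= b)%N >-> a <= b}.
  by move=> a b ab; rewrite lee_fin; exact/lefP/nd_nnsfun_approx.
transitivity (limn (fun n => \int[nu]_(t in D) (h n t)%:E)).
  rewrite -monotone_convergence//.
  - by apply: eq_integral => t /[!inE] Dt; apply/esym/cvg_lim => //; exact: hf.
  - by move=> n; exact/measurable_EFinP/measurable_funTS.
  - by move=> n t _; rewrite lee_fin.
under eq_fun do rewrite integral_weighted_image_nnsfun.
rewrite -monotone_convergence//.
- apply: eq_integral => x /[!inE] Dx; apply/cvg_lim => //.
  by apply: cvgeZr => //; exact: hf.
- move=> n; apply: emeasurable_funM; last exact/measurable_funTS/measurable_EFinP.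
  by apply/measurable_funTS/measurable_EFinP; exact: measurableT_comp.
- by move=> n x _; rewrite mule_ge0 ?lee_fin.
- by move=> x _ a b ab; apply: lee_wpmul2r; [rewrite lee_fin|exact: ndh].
Qed.

End weighted_image.

(** * Integrals over rectangles, with a probability as second factor *)

Section product_factorization.
Context d d1 d2 (T : measurableType d) (T1 : measurableType d1)
  (T2 : measurableType d2) (R : realType).
Variables (mu : {measure set T1 -> \bar R}) (nu : probability T2 R).
Variables (lambda : {measure set T -> \bar R}) (y : T -> T1) (z : T -> T2).
Variable w : T1 -> R.
Hypotheses (my : measurable_fun [set: T] y) (mz : measurable_fun [set: T] z).
Hypotheses (mw : measurable_fun [set: T1] w) (w0 : forall t, 0 <= w t).
Variables (B : set T1) (C : set T2).
Hypotheses (mB : measurable B) (mC : measurable C).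
Local Open Scope ereal_scope.

Let nuC0 : (0 <= fine (nu C))%R.
Proof. exact/fine_ge0/measure_ge0. Qed.

(* Tonelli on a rectangle, without sigma-finiteness of the first factor. *)
Lemma ge0_integral_rectangle_fst (f : T1 -> \bar R) :
  measurable_fun B f -> (forall t, B t -> 0 <= f t) ->
  \int[mu \x nu]_(p in B `*` C) f p.1 = (\int[mu]_(t in B) f t) * nu C.
Proof.
move=> mf f0; rewrite -[nu C]fineK ?fin_num_measure// muleC.
rewrite -(ge0_integral_mscale mu mB (NngNum nuC0) mf)//.
(* The multiple [nu C] of [mu] is the image under [fst] of [mu \x nu] restricted to the strip over
   [C]. *)
rewrite (ge0_integral_weighted_image (mu := mu \x nu) (phi := fst)
  (w := \1_([set: T1] `*` C))) => //; last 2 first.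
- by apply: measurable_indic; exact: measurableX.
- move=> A mA; rewrite integral_indic; last exact: measurableX.
    rewrite /= /mscale /= fineK ?fin_num_measure// muleC.
    rewrite -[RHS]/((mu \x nu) _) (_ : _ `&` _ = A `*` C) ?product_measure1E//.
    by apply/seteqP; split => -[t u] /=; tauto.
  by rewrite -[X in measurable X]setTI; exact: measurable_fst.
rewrite (_ : B `*` C = fst @^-1` B `&` [set: T1] `*` C); last first.
  by apply/seteqP; split => -[t u] /=; tauto.
rewrite integral_mkcondr; apply: eq_integral => p _.
by rewrite epatch_indic.
Qed.

Lemma ge0_integral_factorization (f : T1 -> \bar R) :
  (forall A, measurable A ->
    lambda (y @^-1` A `&` z @^-1` C) = (\int[mu]_(t in A) (w t)%:E) * nu C) ->
  measurable_fun B f -> (forall t, B t -> 0 <= f t) ->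
  \int[lambda]_(x in y @^-1` B `&` z @^-1` C) f (y x) =
  (\int[mu]_(t in B) (f t * (w t)%:E)) * nu C.
Proof.
move=> lambdaE mf f0.
have mzC : measurable (z @^-1` C).
  by rewrite -[X in measurable X]setTI; exact: mz.
have myA A : measurable A -> measurable (y @^-1` A).
  by move=> mA; rewrite -[X in measurable X]setTI; exact: my.
(* [rho] still awaits the measurability of [y], on which the instance depends. *)
pose rho : {measure set T1 -> \bar R} :=
  pushforward (mrestr lambda mzC) y.
rewrite integral_mkcondr.
transitivity (\int[rho my]_(t in B) f t).
  rewrite (ge0_integral_weighted_image (mu := lambda) (phi := y)
    (w := \1_(z @^-1` C))) => //.
    by apply: eq_integral => x _; rewrite epatch_indic.
  move=> A mA; rewrite integral_indic//; last exact: myA.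
  by rewrite setIC.
(* Second description of [rho]: a density over [mu], with [nu C] absorbed into the weight. *)
rewrite (ge0_integral_weighted_image (mu := mu) (phi := id)
  (w := fun t => w t * fine (nu C))%R) => //; last 3 first.
- exact: measurable_funM.
- by move=> t; rewrite mulr_ge0.
- move=> A mA; rewrite [LHS]lambdaE//.
  under [RHS]eq_integral do rewrite EFinM.
  rewrite ge0_integralZr ?lee_fin ?fineK ?fin_num_measure//.
    by apply/measurable_funTS/measurable_EFinP.
  by move=> t _; rewrite lee_fin.
under eq_integral do rewrite EFinM muleA.
rewrite ge0_integralZr ?lee_fin ?fineK ?fin_num_measure//.
  apply: emeasurable_funM => //.
  by apply/measurable_funTS/measurable_EFinP.
by move=> t Bt; rewrite mule_ge0 ?lee_fin ?f0.
Qed.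
End product_factorization.

(** * The multiplier on cosets and the orbital decomposition *)

Lemma multiplier_compact (R : realType) (G : topologicalGroupType)
    (G0 : groupClosed G) (chi : G -> R) :
  multiplier chi -> compact [set` G0] -> forall g, g \in G0 -> chi g = 1.
Proof.
move=> [cchi chi0 chiM] cG0.
have le1 h : h \in G0 -> chi h <= 1.
  move=> G0h; have [||k] := compact_EVT_max (f := chi) _ cG0.
  - by exists 1%g; exact: gpred1.
  - exact: continuous_subspaceT.
  (* At a maximum point [k] of [chi] on [G0], the element [h * k] is again in [G0], so
     [chi h * chi k <= chi k]. Applying the resulting bound to the inverse as well gives
     equality. *)
  rewrite inE/= => G0k /(_ (h * k)%g).
  by rewrite inE/= gpredM// chiM ger_pMl//; exact.
have chi1 : chi 1%g = 1.
  by apply: (mulIf (lt0r_neq0 (chi0 1%g))); rewrite -chiM mul1g mul1r.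
move=> g G0g; apply/le_anti; rewrite le1//=.
rewrite -(ler_pM2r (chi0 g^-1%g)) -chiM mulgV chi1 mul1r.
by rewrite le1// gpredV.
Qed.

Section coset_multiplier.
Context {R : realType} {G : topologicalGroupType}.
Variables (G0 : groupClosed G) (chi : G -> R).
Hypotheses (mchi : multiplier chi) (cG0 : compact [set` G0]).

Lemma coset_projP (g h : G) :
  reflect (coset_proj G0 g = coset_proj G0 h) ((g^-1 * h)%g \in G0).
Proof. exact: (@eqmodP _ (lcoset_equiv G0) g h). Qed.

(** As [chi] is 1 on [G0], its value at [repr y] depends only on the coset, so continuity descends
    to the quotient topology. *)
Lemma continuous_coset_multiplier :
  continuous (coset_multiplier chi : coset_space G0 -> R).
Proof.
case: (mchi) => cchi chi0 chiM; apply: repr_comp_continuous => // g h.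
move => /eqP/coset_projP gh.
apply/eqP; rewrite -[h](mulVKg g) chiM (multiplier_compact mchi cG0 gh).
by rewrite mulr1.
Qed.

End coset_multiplier.

(** The point over [(t, u)] is [act g u] with [g] a representative of [t]. It guarantees that the
    image of the preimage of a rectangle is the whole rectangle. *)
Lemma orbital_decomposition_surjective (G : topologicalGroupType)
    (X : topologicalType) (act : G -> X -> X) (G0 : groupClosed G) (Z : set X)
    (y : X -> coset_space G0) (z : X -> Z) :
  left_action act -> global_cross_section act Z G0 ->
  orbital_decomposition act y z ->
  forall t u, exists x, y x = t /\ z x = u.
Proof.
move=> [act1 actM] [csZ isoZ] decxyz t u.
have Zval (v : Z) : Z (set_val v) by exact: set_valP.
pose g := repr t; exists (act g (set_val u)).
set x := act g _; have [h xh yh] := decxyz x.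
have actV k v : act k^-1%g (act k v) = v by rewrite -actM mulVg act1.
have zu : set_val (z x) = set_val u.
  (* Both [z x] and [u] lie in [Z] and in the orbit of [x], hence coincide. *)
  have [v [_ uniqv]] := csZ x.
  transitivity v; first apply/esym; apply: uniqv; (split; first exact: Zval).
    by exists h^-1%g => //; rewrite {1}xh actV.
  by exists g^-1%g => //; rewrite /x actV.
split; last exact: val_inj.
rewrite yh -[t]reprK -/g; apply/coset_projP.
(* Both [g] and [h] carry [u] to [x], so they differ by an element of the isotropy group of [u]. *)
suff : isotropy act (set_val u) (h^-1 * g)%g by rewrite (isoZ _ (Zval u)).
by rewrite /isotropy/= actM -/x {1}xh actV.
Qed.

Lemma continuous_borel_measurable (S T : topologicalType) (s : S) (t : T)
    (f : S -> T) :
  continuous f -> measurable_fun [set: borel s] (f : borel s -> borel t).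
Proof.
move=> /continuousP cf.
apply: (@measurability _ _ (borel s) (borel t) setT f (@open (pointed_at t))) => //.
move=> _ [U oU <-].
by rewrite setTI; apply: sub_sigma_algebra; exact: cf.
Qed.

Lemma continuous_borel_measurable_real (S : topologicalType) (s : S)
    (R : realType) (f : S -> R) :
  continuous f -> measurable_fun [set: borel s] (f : borel s -> R).
Proof.
move=> /continuousP cf.
apply: (measurability _ (RGenOpens.measurableE R)) => _ [_ [a [b ->]] <-].
rewrite setTI; apply: sub_sigma_algebra; apply: cf; exact: itv_open.
Qed.

(** * Contoured distributions on rectangles *)

Section contoured_rectangle.
Context d d1 d2 (T : measurableType d) (T1 : measurableType d1)
  (T2 : measurableType d2) (R : realType).
Variables (mu : {measure set T1 -> \bar R}) (nu : probability T2 R).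
Variables (lambda : {measure set T -> \bar R}) (y : T -> T1) (z : T -> T2).
Variables (w f : T1 -> R) (P : probability T R).
Hypotheses (my : measurable_fun [set: T] y) (mz : measurable_fun [set: T] z).
Hypotheses (mw : measurable_fun [set: T1] w) (w0 : forall t, 0 <= w t).
Hypothesis mf : measurable_fun [set: T1] f.
Local Open Scope ereal_scope.
Hypothesis lambdaE : forall B C, measurable B -> measurable C ->
  lambda (y @^-1` B `&` z @^-1` C) = (\int[mu]_(t in B) (w t)%:E) * nu C.
Hypothesis PE :
  forall A, measurable A -> P A = \int[lambda]_(x in A) (f (y x))%:E.

Let F : T1 -> \bar R := EFin \o f.

Let mF : measurable_fun [set: T1] F.
Proof. exact/measurable_EFinP. Qed.

Let wE : T1 -> \bar R := EFin \o w.

Let mFn : measurable_fun [set: T1] (fun t => F^\- t * wE t).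
Proof.
by apply: emeasurable_funM; [exact: measurable_funeneg|exact/measurable_EFinP].
Qed.

Let Fn0 t : 0 <= F^\- t * wE t.
Proof. by rewrite mule_ge0// lee_fin. Qed.

Let integral_y (g : T1 -> \bar R) B C :
  measurable B -> measurable C -> measurable_fun [set: T1] g ->
  (forall t, 0 <= g t) ->
  \int[lambda]_(x in y @^-1` B `&` z @^-1` C) g (y x) =
  (\int[mu]_(t in B) (g t * wE t)) * nu C.
Proof.
move=> mB mC mg g0; apply: ge0_integral_factorization => //.
- by move=> A mA; exact: lambdaE.
- exact: measurable_funTS.
Qed.

(* Where [f < 0] the probability [P] would be negative unless that set is null. *)
Let integral_funeneg B : measurable B -> \int[mu]_(t in B) (F^\- t * wE t) = 0.
Proof.
move=> mB; pose N := [set t | F t < 0].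
have mN : measurable N.
  by rewrite -[N]setTI; exact: emeasurable_fun_infty_o.
have FnN t : ~ N t -> F^\- t = 0.
  move=> /negP; rewrite -leNgt => Ft0.
  by rewrite funenegE; apply/max_idPr; rewrite leeNl oppe0.
have intN : \int[mu]_(t in N) (F^\- t * wE t) = 0.
  have mS : measurable (y @^-1` N `&` z @^-1` [set: T2]).
    apply: measurableI; first by rewrite -[X in measurable X]setTI; exact: my.
    by rewrite preimage_setT.
  have : 0 <= P (y @^-1` N `&` z @^-1` [set: T2]) by exact: measure_ge0.
  rewrite PE// integralE integral0_eq; last first.
    move=> x [Nx _]; rewrite funeposE; apply/max_idPr; exact/ltW.
  rewrite sub0e oppe_ge0 (_ : (fun x => (f (y x))%:E)^\- = F^\- \o y); last first.
    by rewrite -funeneg_comp.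
  rewrite integral_y//; last exact: measurable_funeneg.
  rewrite probability_setT mule1 => le0; apply/le_anti; rewrite le0/=.
  by apply: integral_ge0.
apply/le_anti/andP; split; last by apply: integral_ge0.
(* [F^\-] vanishes off [N], so only [B]&[N] contributes, and enlarging it to [N] can only increase
   the integral. *)
rewrite -[leRHS]intN (_ : \int[mu]_(t in B) _ =
    \int[mu]_(t in B `&` N) (F^\- t * wE t)); last first.
  rewrite integral_mkcondr; apply: eq_integral => t _; rewrite /patch.
  by case: ifPn => // /negP; rewrite inE => /FnN ->; rewrite mul0e.
apply: ge0_subset_integral => //; first exact: measurableI.
exact: measurable_funTS.
Qed.

Lemma contoured_rectangle B C : measurable B -> measurable C ->
  P (y @^-1` B `&` z @^-1` C) = (\int[mu]_(t in B) (f t * w t)%:E) * nu C.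
Proof.
move=> mB mC; rewrite PE; last first.
  by apply: measurableI; rewrite -[X in measurable X]setTI; [exact: my|exact: mz].
rewrite integralE.
rewrite (_ : (fun x => _)^\+ = F^\+ \o y); last by rewrite -funepos_comp.
rewrite (_ : (fun x => _)^\- = F^\- \o y); last by rewrite -funeneg_comp.
rewrite !integral_y//; [|exact: measurable_funeneg|exact: measurable_funepos].
rewrite integral_funeneg// mul0e sube0 [in RHS]integralE.
have wE0 t : 0 <= wE t by rewrite lee_fin.
(* Since [w >= 0], the negative part of [f * w] is [F^\- * w], whose integral is 0; likewise the
   positive part is [F^\+ * w]. *)
rewrite [X in _ = (_ - X) * _](_ : _ = 0); last first.
  rewrite -(integral_funeneg mB); apply: eq_integral => t _.
  by rewrite !funenegE EFinM muleC -muleN muleC maxe_pMl// mul0e.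
rewrite sube0; congr (_ * _); apply: eq_integral => t _.
by rewrite !funeposE EFinM maxe_pMl// mul0e.
Qed.

End contoured_rectangle.

Theorem theorem3p1 (R : realType) (G : topologicalGroupType)
    (X : topologicalType) (act : G -> X -> X) (G0 : groupClosed G)
    (Z : set X) (z0 : Z)
    (y : X -> coset_space G0) (z : X -> Z)
    (chi : G -> R)
    (muG : {measure set (borel (1%g : G)) -> \bar R})
    (nuZ : probability (borel z0) R)
    (lambda : {measure set (borel (set_val z0 : X)) -> \bar R}) :
  hausdorff_space X -> locally_compact [set: X] ->
  second_countable (T := G) -> hausdorff_space G -> locally_compact [set: G] ->
  left_action act -> continuous_action act ->
  global_cross_section act Z G0 ->
  compact [set` G0] ->
  locally_compact [set: Z] ->
  orbital_decomposition act y z ->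
  bimeasurable ((fun x => (y x, z x)) :
    borel (set_val z0 : X) -> borel ((coset_proj G0 1%g, z0) : coset_space G0 * Z)) ->
  multiplier chi ->
  relatively_invariant act chi lambda ->
  left_haar muG ->
  orbital_factorization y z chi muG nuZ lambda ->
  exists Q : probability (borel z0) R,
    forall (d : measure_display) (Omega : measurableType d)
      (P : probability Omega R) (x : {RV P >-> borel (set_val z0 : X)})
      (f : borel (coset_proj G0 1%g) -> R),
    cross_sectionally_contoured y lambda f (distribution P x) ->
    [/\ independent_RVs P
          (y \o x : Omega -> borel (coset_proj G0 1%g))
          (z \o x : Omega -> borel z0),
        forall C : set (borel z0), measurable C ->
          pushforward P (z \o x : Omega -> borel z0) C = Q C &
        forall B : set (borel (coset_proj G0 1%g)), measurable B ->
          pushforward P (y \o x : Omega -> borel (coset_proj G0 1%g)) B =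
          (\int[coset_measure G0 muG]_(t in B)
             (f t * coset_multiplier chi t)%:E)%E].
Proof.
move=> _ _ _ _ _ act_left _ gcs cG0 _ decxyz [mphi _] mchi _ _ fact.
have cproj : continuous (coset_proj G0 : G -> coset_space G0).
  exact: pi_continuous.
pose pi0 := coset_proj G0 : borel (1%g : G) -> borel (coset_proj G0 1%g).
have mpi : measurable_fun [set: borel (1%g : G)] pi0.
  exact: continuous_borel_measurable.
pose muY' : {measure set (borel (coset_proj G0 1%g)) -> \bar R} :=
  pushforward muG pi0.
pose muY := muY' mpi.
have my : measurable_fun [set: borel (set_val z0 : X)]
    (y : borel (set_val z0 : X) -> borel (coset_proj G0 1%g)).
  (* The pair is measurable for the Borel sets of the product topology, for which the coordinate
     projections are measurable by continuity. *)
  apply: (measurableT_comp (f := (fst : borel ((coset_proj G0 1%g, z0) :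
    coset_space G0 * Z) -> borel (coset_proj G0 1%g))) _ mphi).
  by apply: continuous_borel_measurable => p; exact: cvg_fst.
have mz : measurable_fun [set: borel (set_val z0 : X)]
    (z : borel (set_val z0 : X) -> borel z0).
  apply: (measurableT_comp (f := (snd : borel ((coset_proj G0 1%g, z0) :
    coset_space G0 * Z) -> borel z0)) _ mphi).
  by apply: continuous_borel_measurable => p; exact: cvg_snd.
have mw : measurable_fun [set: borel (coset_proj G0 1%g)]
    (coset_multiplier chi : coset_space G0 -> R).
  apply: continuous_borel_measurable_real.
  exact: continuous_coset_multiplier mchi cG0.
have w0 (t : coset_space G0) : 0 <= coset_multiplier chi t.
  by case: mchi => _ chi0 _; rewrite ltW//; exact: chi0.
have lambdaE (B : set (borel (coset_proj G0 1%g))) (C : set (borel z0)) :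
    measurable B -> measurable C ->
    lambda (y @^-1` B `&` z @^-1` C) =
    ((\int[muY]_(t in B) (coset_multiplier chi t)%:E) * nuZ C)%E.
  move=> mB mC; rewrite fact; last first.
    by apply: measurableI; rewrite -[X in measurable X]setTI; [exact: my|exact: mz].
  rewrite (_ : [set _ | _ in _] = B `*` C); last first.
    apply/seteqP; split => [_ [x [Bx Cx] <-]//|[t u] [/= Bt Cu]].
    have [x [yx zx]] := orbital_decomposition_surjective act_left gcs decxyz t u.
    by exists x; [rewrite /= yx zx|rewrite yx zx].
  rewrite -(ge0_integral_rectangle_fst muY)//.
    exact/measurable_funTS/measurable_EFinP.
  by move=> t _; rewrite lee_fin.
(* The law of [z] is [nuZ], fixed before [f] is introduced. *)
exists nuZ => d Omega P x f [mf PE].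
have rectE (B : set (borel (coset_proj G0 1%g))) (C : set (borel z0)) :
    measurable B -> measurable C ->
    P ((y \o x) @^-1` B `&` (z \o x) @^-1` C) =
    ((\int[muY]_(t in B) (f t * coset_multiplier chi t)%:E) * nuZ C)%E.
  move=> mB mC.
  exact: (contoured_rectangle my mz mw w0 mf lambdaE (P := distribution P x) PE mB mC).
have PyE (B : set (borel (coset_proj G0 1%g))) : measurable B ->
    P ((y \o x) @^-1` B) =
    (\int[muY]_(t in B) (f t * coset_multiplier chi t)%:E)%E.
  move=> mB; have := rectE B setT mB measurableT.
  by rewrite preimage_setT setIT probability_setT mule1.
have PzE (C : set (borel z0)) : measurable C -> P ((z \o x) @^-1` C) = nuZ C.
  (* The factor in front of [nuZ C] is the total mass of the law of [y], namely 1. *)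
  move=> mC; have := rectE setT C measurableT mC.
  by rewrite preimage_setT setTI -PyE// preimage_setT probability_setT mul1e.
split=> //.
by move=> B C mB mC; rewrite rectE// PyE// PzE.
Qed.
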